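(* Let $n,T\ge 1$ be integers and $a_1,\dots,a_n\in\mathbb{R}$, and consider the scalar polynomial system with state $x_t\in\mathbb{R}$, input $u_t\in\mathbb{R}$ and disturbance $w_t\in\mathbb{R}$, $$x_t=\sum_{j=1}^n a_j x_{t-1}^j+u_{t-1}+w_t .$$ Let $\alpha_j^{(k)}\in[0,1]$ ($0\le k\le T-1$, $1\le j\le c_k$) be arbitrary, and let $g_j^{(k)}$ ($0\le k\le T$, $1\le j\le c_k$) be the monomial functions determined by the recursion given in the context. Define $$\Psi^x(w_{t:t-T})=\sum_{k=0}^{T-1}\sum_{j=1}^{c_k}\bigl(1-\alpha_j^{(k)}\bigr)g_j^{(k)}(w_{t-1:t-1-k})+w_t,$$ $$\Psi^u(w_{t:t-T})=-\sum_{k=0}^{T-1}\sum_{j=1}^{c_k}\alpha_j^{(k)}g_j^{(k)}(w_{t:t-k})-\sum_{j=1}^{c_T}g_j^{(T)}(w_{t:t-T}).$$ Then $(\Psi^x,\Psi^u)$ satisfies the SLS achievability constraint for this system, i.e. for every real disturbance sequence $(w_s)_{s\in\mathbb{Z}}$ and every $t$, $$\Psi^x(w_{t:t-T})=\sum_{j=1}^n a_j\bigl(\Psi^x(w_{t-1:t-1-T})\bigr)^j+\Psi^u(w_{t-1:t-1-T})+w_t,$$ and it results in a finite impulse response (FIR) stabilizing controller, in the sense given in the context.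
   Context: Notation: $w_{t:t-k}$ denotes the list $(w_t,w_{t-1},\dots,w_{t-k})$. Monomial functions $g_j^{(k)}$. Each $g_j^{(k)}$ is a function of $k+1$ real variables of the form $g_j^{(k)}(w_{t:t-k})=b_j^{(k)}\,w_t^{p_0}w_{t-1}^{p_1}\cdots w_{t-k}^{p_k}$, with a real constant $b_j^{(k)}$ and a multi-index $p^{(j,k)}=(p_0,\dots,p_k)$ of nonnegative integers with $p_k\ge 1$. For $k=0$: $c_0=n$ and $g_j^{(0)}(w_t)=a_jw_t^j$ for $j=1,\dots,n$. Given $g_j^{(m)}$ and $\alpha_j^{(m)}$ for all $0\le m\le k$ and $1\le j\le c_m$ (where $0\le k\le T-1$), the functions $g_j^{(k+1)}$, $1\le j\le c_{k+1}$, are the monomial terms (with distinct multi-indices, enumerated in any fixed order, $c_{k+1}$ being their number) that involve $w_{t-k-1}$ with positive exponent in the complete expansion of the right-hand side below, so that the following polynomial identity holds: $$\sum_{m=0}^{k+1}\sum_{j=1}^{c_m}g_j^{(m)}(w_{t:t-m})=\sum_{l=1}^n a_l\left(\sum_{m=0}^{k}\sum_{j=1}^{c_m}\bigl(1-\alpha_j^{(m)}\bigr)g_j^{(m)}(w_{t-1:t-1-m})+w_t\right)^l .$$ (The monomials of the right-hand side not involving $w_{t-k-1}$ are exactly those given by the $g_j^{(m)}(w_{t:t-m})$ with $m\le k$.) The coefficients $b_j^{(k)}$ may depend on the parameters $\alpha_j^{(m)}$ with $m<k$. FIR stabilizing controller. The system is at rest before time $0$: $x_t=u_t=0$ for $t<0$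 and $w_t=0$ for $t<0$ (so $x_0=w_0$). The controller is the causal state feedback controller $u_t=\Psi^u(w_{t:t-T})$, where the disturbances are reconstructed from the observed states and past inputs by $w_t=x_t-\sum_{j=1}^n a_jx_{t-1}^j-u_{t-1}$. It is FIR stabilizing with closed-loop maps $(\Psi^x,\Psi^u)$ if, for every disturbance sequence, the closed-loop trajectory satisfies $x_t=\Psi^x(w_{t:t-T})$ and $u_t=\Psi^u(w_{t:t-T})$ for all $t\ge0$. Thus the state and input at time $t$ depend only on $w_t,\dots,w_{t-T}$, so each disturbance is rejected after $T$ time steps. *)

(* Defs.v *)
From HB Require Import structures.
From mathcomp Require Import all_boot all_order all_algebra.
From mathcomp Require Import reals.
From mathcomp Require Import mpoly.

Set Implicit Arguments.
Unset Strict Implicit.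
Unset Printing Implicit Defensive.

Import Order.TTheory GRing.Theory Num.Theory.
Local Open Scope ring_scope.

(** The scalar polynomial system
      x_t = \sum_(1 <= j <= n) a_j x_(t-1)^j + u_(t-1) + w_t.
    Only the values [a 1], ..., [a n] of [a : nat -> R] are used. *)
Definition drift (R : realType) (n : nat) (a : nat -> R) (x : R) : R :=
  \sum_(1 <= j < n.+1) a j * x ^+ j.

(** [window k w t] is the list w_(t:t-k): entry [i] is w_(t-i). *)
Definition window (R : realType) (k : nat) (w : int -> R) (t : int) :
    'I_k.+1 -> R :=
  fun i => w (t - (i : nat)%:Z).
Arguments window {R} k w t _.

(** If [v] is the list w_(t:t-N), then [subwindow d k v] is w_(t-d:t-d-k).
    It is only used with [d + k <= N], where [inord] is the identity. *)
Definition subwindow (R : realType) (N d k : nat) (v : 'I_N.+1 -> R) :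
    'I_k.+1 -> R :=
  fun i => v (inord (d + i)).
Arguments subwindow {R N} d k v _.

(** ** Monomial functions

    A family of monomial functions is given by the counts [c k], the
    coefficients [b k j] and the multi-indices [p k j].  The index
    [j : 'I_(c k)] starts at 0, so it stands for j + 1 in 1, ..., c_k.
    In [{mpoly R[k.+1]}] the variable ['X_i] stands for w_(t-i). *)

Definition gmon (R : realType) (c : nat -> nat)
    (b : forall k, 'I_(c k) -> R) (p : forall k, 'I_(c k) -> 'X_{1..k.+1})
    (k : nat) (j : 'I_(c k)) : {mpoly R[k.+1]} :=
  b k j *: 'X_[p k j].

(** The right-hand side of the recursion producing level k + 1, a polynomial in
    w_t, ..., w_(t-k-1).  The composition [\mPo] substitutes w_(t-1-i) for
    w_(t-i). *)
Definition rhs (R : realType) (n : nat) (a : nat -> R) (c : nat -> nat)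
    (b : forall k, 'I_(c k) -> R) (p : forall k, 'I_(c k) -> 'X_{1..k.+1})
    (alpha : forall k, 'I_(c k) -> R) (k : nat) : {mpoly R[k.+2]} :=
  \sum_(1 <= l < n.+1)
     a l *: (\sum_(m < k.+1) \sum_(j < c m)
                (1 - alpha m j) *:
                  (gmon b p j \mPo [tuple 'X_(inord i.+1) | i < m.+1])
             + 'X_ord0) ^+ l.

(** [b] and [p] are obtained by the recursion, up to level [T].
    - Level 0 consists of the a_j w_t^j, 1 <= j <= n.
    - Level k + 1 lists, in any order and without repetition, the monomial terms
      of [rhs k] in which w_(t-k-1) has positive exponent.
    Level 0 keeps the terms with a_j = 0.  Likewise, a level k + 1 may keep
    monomials whose coefficient vanishes for the given a and alpha: all terms of
    nonzero coefficient have to be listed, terms of zero coefficient may be. *)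
Definition monomial_recursion (R : realType) (n T : nat) (a : nat -> R)
    (c : nat -> nat)
    (b : forall k, 'I_(c k) -> R) (p : forall k, 'I_(c k) -> 'X_{1..k.+1})
    (alpha : forall k, 'I_(c k) -> R) : Prop :=
  [/\ c 0%N = n,
      forall j : 'I_(c 0%N), b 0%N j = a j.+1 /\ p 0%N j = (U_(ord0) *+ j.+1)%MM
    & forall k, (k < T)%N ->
      [/\ injective (p k.+1),
          forall j : 'I_(c k.+1),
            (0 < p k.+1 j ord_max)%N /\
            b k.+1 j = (rhs n a b p alpha k)@_(p k.+1 j)
        & forall m : 'X_{1..k.+2},
            m \in msupp (rhs n a b p alpha k) -> (0 < m ord_max)%N ->
            exists j : 'I_(c k.+1), p k.+1 j = m]].

Definition Psi_x (R : realType) (T : nat) (c : nat -> nat)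
    (b : forall k, 'I_(c k) -> R) (p : forall k, 'I_(c k) -> 'X_{1..k.+1})
    (alpha : forall k, 'I_(c k) -> R) (v : 'I_T.+1 -> R) : R :=
  \sum_(k < T) \sum_(j < c k)
     (1 - alpha k j) * (gmon b p j).@[subwindow 1 k v]
  + v ord0.

Definition Psi_u (R : realType) (T : nat) (c : nat -> nat)
    (b : forall k, 'I_(c k) -> R) (p : forall k, 'I_(c k) -> 'X_{1..k.+1})
    (alpha : forall k, 'I_(c k) -> R) (v : 'I_T.+1 -> R) : R :=
  - (\sum_(k < T) \sum_(j < c k)
       alpha k j * (gmon b p j).@[subwindow 0 k v])
  - \sum_(j < c T) (gmon b p j).@[v].

(** ** Achievability and FIR stabilization *)

Definition achievable (R : realType) (n T : nat) (a : nat -> R)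
    (Px Pu : ('I_T.+1 -> R) -> R) : Prop :=
  forall (w : int -> R) (t : int),
    Px (window T w t) =
      drift n a (Px (window T w (t - 1))) + Pu (window T w (t - 1)) + w t.

Definition reconstructed (R : realType) (n : nat) (a : nat -> R)
    (x u : int -> R) (t : int) : R :=
  x t - drift n a (x (t - 1)) - u (t - 1).

(** The controller acts on the disturbances reconstructed from [x] and [u],
    not on [w] itself. *)
Definition closed_loop (R : realType) (n T : nat) (a : nat -> R)
    (Pu : ('I_T.+1 -> R) -> R) (w x u : int -> R) : Prop :=
  [/\ forall t, t < 0 -> x t = 0 /\ u t = 0,
      forall t, 0 <= t -> x t = drift n a (x (t - 1)) + u (t - 1) + w t
    & forall t, 0 <= t -> u t = Pu (window T (reconstructed n a x u) t)].

(** The first conjunct is the existence of the closed-loop trajectory; the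
    second one contains its uniqueness. *)
Definition fir_stabilizing (R : realType) (n T : nat) (a : nat -> R)
    (Px Pu : ('I_T.+1 -> R) -> R) : Prop :=
  forall w : int -> R, (forall t, t < 0 -> w t = 0) ->
    (exists x u : int -> R, closed_loop n a Pu w x u) /\
    (forall x u : int -> R, closed_loop n a Pu w x u ->
       forall t, 0 <= t -> x t = Px (window T w t) /\ u t = Pu (window T w t)).

(* Main.v *)
(** Write x_k for the state that would be reached if only the monomials of
    level below k were fed into [Psi_x].  The drift of x_(k+1), seen as a
    polynomial in w_t, ..., w_(t-k-1), splits into the terms that involve
    w_(t-k-1), which form level k + 1 of the recursion, and its value at
    w_(t-k-1) = 0, which is the drift of x_k since every level-k monomial of
    x_(k+1) contains w_(t-k-1).  By induction the drift of x_T is the sum of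
    all the monomials of levels 0, ..., T.  The input [Psi_u] cancels from it
    all of level T and the fraction alpha of the lower levels, and what is left
    is the next value of [Psi_x].

    As the reconstructed disturbance is the true one, the closed loop follows
    the pair ([Psi_x], [Psi_u]). *)

Require Import Defs.
From mathcomp Require Import all_boot all_order all_algebra.
From mathcomp Require Import boolp reals.
From mathcomp Require Import mpoly.
From mathcomp Require Import ring.

Import Order.TTheory GRing.Theory Num.Theory.
Local Open Scope ring_scope.

Set Implicit Arguments.
Unset Strict Implicit.
Unset Printing Implicit Defensive.

(** Setting the variable [i0] to 0 kills exactly the monomials that contain it and leaves the value
    of the others unchanged. *)
Lemma meval_split_var (R : comNzRingType) (N : nat) (P : {mpoly R[N]})
    (i0 : 'I_N) (v : 'I_N -> R) :
  P.@[v] = \sum_(m <- msupp P | (0 < m i0)%N) P@_m * \prod_i v i ^+ m i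
           + P.@[fun i => if i == i0 then 0 else v i].
Proof.
rewrite !mevalE (bigID (fun m : 'X_{1..N} => (0 < m i0)%N)) /=; congr (_ + _).
rewrite [RHS](bigID (fun m : 'X_{1..N} => (0 < m i0)%N)) /=.
rewrite [X in _ = X + _]big1 ?add0r => [|m m_gt0]; last first.
  by rewrite (bigD1 i0) //= eqxx expr0n gtn_eqF // mul0r mulr0.
apply: eq_bigr => m; rewrite -eqn0Ngt => /eqP m0; congr (_ * _).
apply: eq_bigr => i _; case: eqP => [->|//].
by rewrite m0 !expr0.
Qed.

(** [q] may list monomials outside the support: their coefficient is 0, so the surplus terms add
    nothing. *)
Lemma sum_msupp_listed (R : nzRingType) (N : nat) (P : {mpoly R[N]})
    (Q : pred 'X_{1..N}) (F : 'X_{1..N} -> R) (I : finType)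
    (q : I -> 'X_{1..N}) :
  injective q -> (forall j, Q (q j)) ->
  (forall m, m \in msupp P -> Q m -> exists j, q j = m) ->
  \sum_(m <- msupp P | Q m) P@_m * F m = \sum_j P@_(q j) * F (q j).
Proof.
move=> q_inj Qq q_all.
rewrite -(big_map q xpredT (fun m => P@_m * F m)).
rewrite [RHS](bigID (fun m => m \in msupp P)) /=.
rewrite [X in _ = _ + X]big1 ?addr0 => [|m /memN_msupp_eq0 ->]; last first.
  by rewrite mul0r.
rewrite -[LHS]big_filter -[RHS]big_filter; apply/perm_big/uniq_perm.
- exact/filter_uniq/msupp_uniq.
- by rewrite filter_uniq // map_inj_uniq // index_enum_uniq.
move=> m; rewrite !mem_filter andbC; case mP: (m \in msupp P) => //=.
apply/idP/mapP => [/(q_all _ mP) [j <-]|[j _ ->]]; last exact: Qq.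
by exists j; rewrite ?mem_index_enum.
Qed.

(** With a sequence indexed by [nat], the monomials of all levels and their delayed versions read
    the same [z], without casts between ordinal types. *)
Definition gval (R : realType) (c : nat -> nat) (b : forall k, 'I_(c k) -> R)
    (p : forall k, 'I_(c k) -> 'X_{1..k.+1}) (z : nat -> R) (k : nat)
    (j : 'I_(c k)) : R :=
  (gmon b p j).@[fun i : 'I_k.+1 => z i].

(** Here [z i] stands for w_(t-i). *)
Definition truncated_state (R : realType) (c : nat -> nat)
    (b : forall k, 'I_(c k) -> R) (p : forall k, 'I_(c k) -> 'X_{1..k.+1})
    (alpha : forall k, 'I_(c k) -> R) (K : nat) (z : nat -> R) : R :=
  \sum_(k < K) \sum_(j < c k) (1 - alpha k j) * gval b p (fun i => z i.+1) j
  + z 0%N.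

Section Recursion.

Context (R : realType) (n : nat) (a : nat -> R) (c : nat -> nat).
Context (b : forall k, 'I_(c k) -> R) (p : forall k, 'I_(c k) -> 'X_{1..k.+1}).
Context (alpha : forall k, 'I_(c k) -> R).
Arguments alpha {k} : rename.
Implicit Types z : nat -> R.

Lemma gvalE z k (j : 'I_(c k)) :
  gval b p z j = b j * \prod_(i < k.+1) z i ^+ p j i.
Proof. by rewrite /gval /gmon mevalZ mevalX. Qed.

Lemma gval_eq0 z k (j : 'I_(c k)) (i : 'I_k.+1) :
  (0 < p j i)%N -> z i = 0 -> gval b p z j = 0.
Proof.
move=> p_gt0 z0; rewrite gvalE (bigD1 i) //= z0 expr0n gtn_eqF //.
by rewrite mul0r mulr0.
Qed.

Lemma eq_gval z z' k (j : 'I_(c k)) :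
  (forall i : nat, (i <= k)%N -> z i = z' i) -> gval b p z j = gval b p z' j.
Proof. by move=> zz'; apply: meval_eq => i; apply: zz'; rewrite -ltnS. Qed.

Lemma meval_rhs k z :
  (rhs n a b p (@alpha) k).@[fun i : 'I_k.+2 => z i] =
  drift n a (truncated_state b p (@alpha) k.+1 z).
Proof.
rewrite /rhs /drift raddf_sum; apply: eq_bigr => l _.
rewrite /= mevalZ rmorphXn /= mevalD mevalXU; congr (_ * (_ + _) ^+ _).
rewrite raddf_sum; apply: eq_bigr => m _; rewrite /= raddf_sum.
apply: eq_bigr => j _; rewrite /= mevalZ comp_mpoly_meval; congr (_ * _).
apply: meval_eq => i; rewrite tnth_mktuple mevalXU inordK // ltnS.
exact: leq_trans (ltn_ord i) (ltn_ord m).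
Qed.

Context (T : nat) (hrec : monomial_recursion n T a b p (@alpha)).

Lemma multi_index_last_gt0 k (j : 'I_(c k)) : (k <= T)%N -> (0 < p j ord_max)%N.
Proof.
case: hrec => c0 base step; case: k j => [|k] j kT; last first.
  by case: (step k kT) => _ /(_ j) [].
by case: (base j) => _ ->; rewrite mulmnE mnm1E -val_eqE.
Qed.

Lemma drift_truncated_state k z : (k <= T)%N ->
  drift n a (truncated_state b p (@alpha) k z) =
  \sum_(m < k.+1) \sum_(j < c m) gval b p z j.
Proof.
elim: k => [_|k IHk kT].
  rewrite /truncated_state big_ord0 add0r big_ord1.
  case: hrec => c0 base _; rewrite /drift -[in LHS]c0 big_add1 big_mkord.
  apply: eq_bigr => j _; case: (base j) => bj pj.
  by rewrite gvalE bj pj big_ord1 mulmnE mnm1E eqxx mul1n.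
case: hrec => c0 base /(_ k kT) [p_inj p_coef p_all].
rewrite big_ord_recr /= -(IHk (ltnW kT)) -meval_rhs.
rewrite (meval_split_var _ ord_max) addrC; congr (_ + _).
  pose mon (m : 'X_{1..k.+2}) := \prod_(i < k.+2) z i ^+ m i.
  have p_gt0 (j : 'I_(c k.+1)) : (0 < p j ord_max)%N by case: (p_coef j).
  rewrite [LHS](sum_msupp_listed mon p_inj p_gt0 p_all).
  by apply: eq_bigr => j _; rewrite gvalE; case: (p_coef j) => _ ->.
pose z' i := if i == k.+1 then 0 else z i.
rewrite (_ : _.@[_] = (rhs n a b p (@alpha) k).@[fun i : 'I_k.+2 => z' i]);
  last by apply: meval_eq => i; rewrite -val_eqE.
rewrite meval_rhs; congr drift; rewrite /truncated_state big_ord_recr /=.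
(* The last variable of each delayed level-k monomial is [z' k.+1], which is 0. *)
rewrite [X in _ + X + _]big1 ?addr0 => [|j _]; last first.
  rewrite (gval_eq0 (i := ord_max)) ?mulr0 ?multi_index_last_gt0 1?ltnW //=.
  by rewrite /z' eqxx.
(* Delayed monomials of levels below k read at most [z 1], ..., [z k], where [z'] agrees with
   [z]. *)
congr (_ + _); apply: eq_bigr => m _; apply: eq_bigr => j _; congr (_ * _).
apply: eq_gval => i im; rewrite /z' ltn_eqF // ltnS.
exact: leq_ltn_trans im (ltn_ord m).
Qed.

Lemma Psi_x_window (w : int -> R) t :
  Psi_x b p (@alpha) (window T w t) =
  truncated_state b p (@alpha) T (fun i => w (t - i%:Z)).
Proof.
congr (_ + _); apply: eq_bigr => k _; apply: eq_bigr => j _; congr (_ * _).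
apply: meval_eq => i; rewrite /subwindow /window inordK // ltnS.
exact: leq_trans (ltn_ord i) (ltn_ord k).
Qed.

Lemma Psi_u_window (w : int -> R) t :
  Psi_u b p (@alpha) (window T w t) =
  - (\sum_(k < T) \sum_(j < c k) alpha j * gval b p (fun i => w (t - i%:Z)) j)
  - \sum_(j < c T) gval b p (fun i => w (t - i%:Z)) j.
Proof.
congr (- _ - _); apply: eq_bigr => k _; apply: eq_bigr => j _; congr (_ * _).
apply: meval_eq => i; rewrite /subwindow /window inordK //.
exact: ltn_trans (leq_trans (ltn_ord i) (ltn_ord k)) (ltnSn T).
Qed.

Lemma achievable_Psi :
  achievable n a (Psi_x (T := T) b p (@alpha)) (Psi_u (T := T) b p (@alpha)).
Proof.
move=> w t; rewrite !Psi_x_window Psi_u_window drift_truncated_state //.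
(* Level T, split off here, cancels against the last sum of [Psi_u]. *)
rewrite big_ord_recr /= /truncated_state subr0.
rewrite addrA addrAC addrK -sumrB; congr (_ + _); apply: eq_bigr => k _.
rewrite -sumrB; apply: eq_bigr => j _; rewrite mulrBl mul1r.
rewrite (_ : (fun i => _) = fun i : nat => w (t - 1 - i%:Z)) //.
by apply/funext => i; congr w; rewrite intS opprD addrA.
Qed.

(** Every monomial contains its oldest variable, so none is constant and all vanish on a zero
    window. *)
Lemma Psi_x_at_rest (w : int -> R) t : (forall s, s <= t -> w s = 0) ->
  Psi_x b p (@alpha) (window T w t) = 0.
Proof.
move=> w0; rewrite Psi_x_window /truncated_state w0 ?lerBlDr ?lerDl // addr0.
rewrite big1 // => k _; rewrite big1 // => j _.
rewrite (gval_eq0 (i := ord_max)) ?mulr0 ?multi_index_last_gt0 1?ltnW //.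
by rewrite w0 // lerBlDr lerDl.
Qed.

Lemma Psi_u_at_rest (w : int -> R) t : (forall s, s <= t -> w s = 0) ->
  Psi_u b p (@alpha) (window T w t) = 0.
Proof.
move=> w0; have g0 k (j : 'I_(c k)) : (k <= T)%N ->
    gval b p (fun i => w (t - i%:Z)) j = 0.
  move=> kT; rewrite (gval_eq0 (i := ord_max)) ?multi_index_last_gt0 //.
  by rewrite w0 // lerBlDr lerDl.
rewrite Psi_u_window !big1 ?oppr0 ?addr0 // => [j _|k _]; first exact: g0.
by rewrite big1 // => j _; rewrite g0 ?mulr0 // ltnW.
Qed.

End Recursion.

Lemma closed_loop_reconstructed (R : realType) (n T : nat) (a : nat -> R)
    (Pu : ('I_T.+1 -> R) -> R) (w x u : int -> R) :
  (forall t, t < 0 -> w t = 0) -> closed_loop n a Pu w x u ->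
  reconstructed n a x u = w.
Proof.
move=> w0 [rest dyn _]; apply/funext => t; rewrite /reconstructed.
have [t_ge0|t_lt0] := lerP 0 t; first by rewrite dyn //; ring.
have [xt _] := rest t t_lt0; have [xt1 ut1] : x (t - 1) = 0 /\ u (t - 1) = 0.
  by apply: rest; rewrite subr_lt0 (lt_trans t_lt0).
(* Before time 0 both sides are 0, because the drift has no constant term. *)
rewrite xt xt1 ut1 w0 // /drift big_nat big1 ?subrr // => j /andP[j_gt0 _].
by rewrite expr0n gtn_eqF // mulr0.
Qed.

(** The pair evaluated along [w] is itself a trajectory; any other one agrees with it by induction
    on time. *)
Lemma achievable_fir_stabilizing (R : realType) (n T : nat) (a : nat -> R)
    (Px Pu : ('I_T.+1 -> R) -> R) :
  achievable n a Px Pu ->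
  (forall w t, (forall s, s <= t -> w s = 0) ->
     Px (window T w t) = 0 /\ Pu (window T w t) = 0) ->
  fir_stabilizing n a Px Pu.
Proof.
move=> ach at_rest w w0.
have rest t : t < 0 -> Px (window T w t) = 0 /\ Pu (window T w t) = 0.
  by move=> t_lt0; apply: at_rest => s st; apply/w0/(le_lt_trans st).
split=> [|x u xu].
  exists (fun t => Px (window T w t)), (fun t => Pu (window T w t)).
  split=> [//|t _|t _]; first exact: ach.
  (* Achievability holds at all times, so this trajectory reconstructs exactly [w], negative times
     included. *)
  congr (Pu (window T _ t)); apply/funext => s.
  by rewrite /reconstructed ach; ring.
have rec_w := closed_loop_reconstructed w0 xu; case: xu => xu_rest dyn ctl.
have uE t : u t = Pu (window T w t).
  have [t_ge0|t_lt0] := lerP 0 t; first by rewrite ctl // rec_w.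
  by rewrite (xu_rest t t_lt0).2 (rest t t_lt0).2.
(* The shift by one starts the induction at time -1, where both sides are 0 by rest, so time 0 is no
   special case. *)
suff xE (k : nat) : x (k%:Z - 1) = Px (window T w (k%:Z - 1)).
  by case=> // k _; split=> //; have := xE k.+1; rewrite intS addrC addKr.
elim: k => [|k IHk]; first by rewrite (xu_rest _ _).1 ?(rest _ _).1.
by rewrite intS addrC addKr dyn // ach IHk uE.
Qed.

Theorem theorem2 (R : realType) (n T : nat) (a : nat -> R) (c : nat -> nat)
    (b : forall k : nat, 'I_(c k) -> R)
    (p : forall k : nat, 'I_(c k) -> 'X_{1..k.+1})
    (alpha : forall k : nat, 'I_(c k) -> R)
    (hn : (1 <= n)%N) (hT : (1 <= T)%N)
    (halpha : forall k : nat, (k < T)%N ->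
       forall j : 'I_(c k), 0 <= alpha k j <= 1)
    (hrec : monomial_recursion n T a b p alpha) :
  achievable n a (Psi_x (T := T) b p alpha) (Psi_u (T := T) b p alpha) /\
  fir_stabilizing n a (Psi_x (T := T) b p alpha) (Psi_u (T := T) b p alpha).
Proof.
have ach := achievable_Psi hrec.
split=> //; apply: achievable_fir_stabilizing ach _ => w t w0.
by split; [apply: Psi_x_at_rest hrec _ _ w0 | apply: Psi_u_at_rest hrec _ _ w0].
Qed.
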